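(* Let $G$ be an infinite metrizable profinite group such that $\operatorname{non}(\mathcal{M})\le\mathfrak{kum}(G)$, where $\operatorname{non}(\mathcal{M})$ is the minimal cardinality of a nonmeager subset of the Cantor space and $\mathfrak{kum}(G)$ is the Kuratowski--Ulam--Markov number of $G$. Then $G$ has a subgroup that does not have the property of Baire.
   Context: Let $G$ be an infinite metrizable profinite group with identity element $e$. ''Meager'' means of Baire first category in the relevant finite power $G^n$ (with the product topology). Words. Let $X=\{x_1,x_2,\dots\}$ be a countable set of variables, and let $G[X]$ be the set of all words in the alphabet $G\cup\{x_1^{\pm1},x_2^{\pm1},\dots\}$. For $w\in G[X]$, let $|w|$ be the (finite) number of variables occurring in $w$; the set $G[X]\setminus G$ consists of the words in which at least one variable occurs. A word $w\in G[X]\setminus G$ whose variables are $x_{i_1},\dots,x_{i_n}$ ($i_1<\dots<i_n$, $n=|w|$) is viewed as a continuous function $w\colon G^{n}\to G$, defined by substituting group elements for the variables and multiplying in $G$. Markov sets. A Markov set is a set of the form $w^{-1}(e)=\{h\in G^{|w|}: w(h)=e\}$ for some $w\in G[X]\setminus G$; it is a subset of $G^{|w|}$. A Markov meager set is a Markov subset of some finite power $G^n$ that is meager in $G^n$. Fibers. For $n\ge2$, $A\subseteq G^n$ and $g\in G$, let $A_g:=\{h\in G^{n-1}:(h,g)\in A\}$. Kuratowski--Ulam--Markov sets. A set $N\subseteq G$ is Kuratowski--Ulam--Markov if either (1) $N$ is a Markov meager subset of $G$, or (2) there are a natural number $n\ge2$ and a Markov meager set $A\subseteq G^n$ such that $N=\{g\in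 G: A_g\text{ is nonmeager in }G^{n-1}\}$. Kuratowski--Ulam--Markov number. $\mathfrak{kum}(G)$ is the minimal number (cardinality) of Kuratowski--Ulam--Markov sets in $G$ whose union is comeager in $G$ (i.e., has meager complement). $\mathcal{M}$ is the ideal of meager subsets of the Cantor space $\{0,1\}^{\mathbb{N}}$. *)

(* Defs.v *)
From HB Require Import structures.
From mathcomp Require Import all_boot all_order all_algebra.
From mathcomp Require Import all_classical all_reals all_analysis.

Set Implicit Arguments.
Unset Strict Implicit.
Unset Printing Implicit Defensive.

Import Order.TTheory GRing.Theory Num.Theory.

Local Open Scope classical_set_scope.
Local Open Scope card_scope.

HB.structure Definition PreTopologicalGroup := {G of Topological G & Group G}.

HB.mixin Record PreTopologicalGroup_isTopologicalGroup G
    & PreTopologicalGroup G := {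
  mulg_continuous : continuous (fun x : G * G => (x.1 * x.2)%g) ;
  invg_continuous : continuous (fun x : G => (x^-1)%g) ;
}.

#[short(type="topologicalGroupType")]
HB.structure Definition TopologicalGroup :=
  {G of PreTopologicalGroup G & PreTopologicalGroup_isTopologicalGroup G}.

(* A group is an inverse limit of finite discrete groups exactly when it is a
   compact Hausdorff totally disconnected topological group. *)
Definition profinite (G : topologicalGroupType) : Prop :=
  [/\ compact [set: G], hausdorff_space G & totally_disconnected [set: G]].

Definition metrizable (R : realType) (T : topologicalType) : Prop :=
  exists d : T -> T -> R,
    [/\ forall x y, d x y = 0%R <-> x = y,
        forall x y, d x y = d y x,
        forall x y z, (d x z <= d x y + d y z)%R &
        forall x (A : set T),
          nbhs x A <-> exists2 e : R, (0 < e)%R & [set y | (d x y < e)%R] `<=` A].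

Definition subgroup (G : groupType) (H : set G) : Prop :=
  [/\ H 1%g, forall x y, H x -> H y -> H (x * y)%g &
      forall x, H x -> H (x^-1)%g].

Section Category.
Context {T : topologicalType}.
Implicit Type A : set T.

Definition nowhere_dense A : Prop := interior (closure A) = set0.

Definition meager A : Prop :=
  exists2 F : nat -> set T, forall k, nowhere_dense (F k) & A = \bigcup_k F k.

Definition comeager A : Prop := meager (~` A).

Definition property_of_Baire A : Prop :=
  exists2 U : set T, open U & meager (A `+` U).

End Category.

(* the power G^n with the product topology *)
Notation fpow G n := (prod_topology (fun _ : 'I_n => G)).

Section Words.
Context {G : groupType}.

(* The variables are indexed by nat; only their relative order matters. *)
Inductive letter : Type :=
  | Const of G
  | Var of nat
  | VarInv of nat.

Definition word : Type := seq letter.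

Definition letter_var (l : letter) : option nat :=
  match l with Const _ => None | Var k | VarInv k => Some k end.

(* the indices i_1 < ... < i_n of the variables occurring in w *)
Definition word_vars (w : word) : seq nat := sort leq (undup (pmap letter_var w)).

Definition word_arity (w : word) : nat := size (word_vars w).

(* The value at x_k of the substitution x_(i_j) := h j for j < n; the default 1
   is never reached on variables of w when n = word_arity w. *)
Definition var_subst (w : word) (n : nat) (h : 'I_n -> G) (k : nat) : G :=
  if insub (index k (word_vars w)) is Some j then h j else 1%g.

Definition letter_eval (s : nat -> G) (l : letter) : G :=
  match l with Const g => g | Var k => s k | VarInv k => ((s k)^-1)%g end.

Definition word_eval (w : word) (n : nat) (h : 'I_n -> G) : G :=
  (\prod_(l <- w) letter_eval (var_subst w h) l)%g.

End Words.
Arguments letter : clear implicits.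
Arguments word : clear implicits.

Section KuratowskiUlamMarkov.
Context {G : topologicalGroupType}.

Definition Markov_set (n : nat) (A : set (fpow G n)) : Prop :=
  exists w : word G,
    [/\ (0 < word_arity w)%N, word_arity w = n &
        A = [set h : fpow G n | word_eval w h = 1%g]].

Definition Markov_meager (n : nat) (A : set (fpow G n)) : Prop :=
  Markov_set A /\ meager A.

(* (h, g) in G^(m+1), with g as the last coordinate *)
Definition fpow_rcons (m : nat) (h : fpow G m) (g : G) : fpow G m.+1 :=
  fun i => if unlift ord_max i is Some j then h j else g.

Definition fiber (m : nat) (A : set (fpow G m.+1)) (g : G) : set (fpow G m) :=
  [set h | A (fpow_rcons h g)].

(* G is identified with G^1 in the first case, and n = m + 1 in the second. *)
Definition KUM_set (N : set G) : Prop :=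
  (exists2 A : set (fpow G 1), Markov_meager A & N = [set g | A (fun=> g)]) \/
  (exists m : nat, exists2 A : set (fpow G m.+1),
     (2 <= m.+1)%N /\ Markov_meager A & N = [set g | ~ meager (fiber A g)]).

Definition KUM_cover (F : set (set G)) : Prop :=
  F `<=` KUM_set /\ comeager (\bigcup_(N in F) N).

End KuratowskiUlamMarkov.

(* A has the least cardinality among the sets satisfying P, that is, #|A| is the
   cardinal min {#|B| : P B}. *)
Definition least_card {T : Type} (P : set T -> Prop) (A : set T) : Prop :=
  P A /\ forall B, P B -> A #<= B.

(* non(M) = #|A| *)
Definition is_nonM (A : set cantor_space) : Prop :=
  least_card (fun B : set cantor_space => ~ meager B) A.

(* kum(G) = #|F| *)
Definition is_kum (G : topologicalGroupType) (F : set (set G)) : Prop :=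
  least_card (@KUM_cover G) F.

(* Such A and F always exist, because cardinals are well ordered, and are unique
   up to equipotence. *)
Definition nonM_le_kum (G : topologicalGroupType) : Prop :=
  exists A (F : set (set G)), [/\ is_nonM A, is_kum F & A #<= F].

(* Main.v *)
From HB Require Import structures.
Require Import Defs.
From mathcomp Require Import all_boot all_order all_algebra.
From mathcomp Require Import all_classical all_reals all_analysis.
From mathcomp Require wochoice.

(** Write [c] for the cardinality of the continuum.  A nonmeager subgroup with
    the property of Baire contains a neighbourhood of the identity
    ([Pettis]), so it is enough to find a nonmeager subgroup that is not open.
    As [G] is compact, metrizable, totally disconnected and has no isolated
    point, it is homeomorphic to the Cantor space; hence a nonmeager subset [A]
    of the Cantor space has a nonmeager copy in [G].  Let [D] be the subgroup
    generated by a dense sequence.  A subgroup [H] containing a neighbourhood of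
    the identity satisfies [G = D H] ([dense_cosets]).

    If [A] has fewer than [c] elements, the subgroup [H] generated by its copy
    is nonmeager; were it to have the property of Baire, then [G = D H] would
    have fewer than [c] elements ([non_Baire_subgroup_small_nonmeager]).

    If [A] has [c] elements, the inequality between the two cardinals says
    that fewer than [c] Kuratowski-Ulam-Markov sets never cover a comeager set.
    Well-order the Cantor space [W], which also codes the F_sigma subsets of
    [G], so that all proper initial segments have fewer than [c] elements, fix
    [t] outside [D], and choose [x a] for [a] in [W] by transfinite recursion:
    outside the F_sigma set coded by [a] if that set is meager, and outside all
    Kuratowski-Ulam-Markov sets given by words whose constants lie in
    [D], [t] and the [x b] with [b < a].  There are fewer than [c] such words, so
    the choice is possible ([generic_family]).  The family [x], hence the
    subgroup [H] generated by [D] and [x], is nonmeager since it escapes every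
    meager F_sigma set.

    The element [t] is not in [H] ([generated_omits]).  Otherwise
    [t = v (x a_1, ..., x a_n)] for a word [v] over [D] and some
    [a_1 > ... > a_n].  The solutions of [v = t] form a closed subset of [G^n];
    it misses the dense set [D^n], because [v] maps [D^n] into [D], so it is
    meager.  Substituting [x a_n], then [x a_(n-1)], and so on, keeps it meager:
    each element avoids the exceptional set of those [g] whose fiber is
    nonmeager, a Kuratowski-Ulam-Markov set with earlier constants
    ([generic_eval_symbols]).  After the last substitution the equation fails,
    a contradiction.  Thus [H] is a proper subgroup; it contains [D], so if it
    contained a neighbourhood of the identity, [G = D H = H] would follow. *)

Set Implicit Arguments.
Unset Strict Implicit.
Unset Printing Implicit Defensive.

Import Order.TTheory GRing.Theory Num.Theory.

Local Open Scope classical_set_scope.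
Local Open Scope card_scope.

(** * Cardinalities *)

Definition embeds (X Y : Type) : Prop := exists f : X -> Y, injective f.

Lemma card_leE (T U : Type) (A : set T) (B : set U) : A #<= B <-> embeds A B.
Proof.
split=> [/card_leP[f]|[f fI]]; first by exists f => x y; apply: inj; rewrite inE.
apply/card_leP/injfunPex; exists f; first by [].
by move=> x y _ _; apply: fI.
Qed.

Lemma card_leTE (X Y : Type) : [set: X] #<= [set: Y] <-> embeds X Y.
Proof.
split=> [/card_leE[f fI]|[f fI]].
  exists (fun x => set_val (f (SigSub (mem_setT x)))) => x y /val_inj /fI.
  by move=> /(congr1 set_val).
apply/card_leE; exists (fun x => SigSub (mem_setT (f (set_val x)))).
by move=> x y /(congr1 set_val) /= /fI /val_inj.
Qed.

Lemma embedsT (Y X Z : Type) : embeds X Y -> embeds Y Z -> embeds X Z.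
Proof. by move=> [f fI] [g gI]; exists (g \o f); apply: inj_comp. Qed.

Lemma embeds_surj (X Y : Type) (f : X -> Y) :
  (forall y, exists x, f x = y) -> embeds Y X.
Proof.
move=> fS; exists (fun y => sval (cid (fS y))) => y y' yy'.
by rewrite -(svalP (cid (fS y))) yy' (svalP (cid (fS y'))).
Qed.

Lemma embeds_count (Q : countType) : embeds Q nat.
Proof. by exists pickle; apply: pcan_inj; apply: pickleK. Qed.

Lemma choice_in (X : Type) (A : set X) (P : X -> X -> Prop) :
  (forall x, A x -> exists y, P x y) ->
  exists f : X -> X, forall x, A x -> P x (f x).
Proof.
move=> AP; have [x|f fP] := @boolp.choice X X (fun x y => A x -> P x y); last first.
  by exists f.
 have [/AP[y Pxy]|NAx] := pselect (A x); first by exists y.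
by exists x.
Qed.

(** A maximal graph of a partial injection from [A] to [C] is either defined on
    all of [A] or onto [C]; otherwise one more pair could be added. *)
Lemma card_comparable (X : Type) (A C : set X) :
  (exists f : X -> X, set_inj A f /\ f @` A `<=` C) \/
  (exists f : X -> X, set_inj C f /\ f @` C `<=` A).
Proof.
pose P (R : set (X * X)) :=
  [/\ forall x y, R (x, y) -> A x /\ C y,
      forall x y y', R (x, y) -> R (x, y') -> y = y' &
      forall x x' y, R (x, y) -> R (x', y) -> x = x'].
have [|R [[RAC Rf Ri] Rmax]] := @Zorn_bigcup (X * X) P.
  move=> F FP Ftot; split.
  - by move=> x y [R /FP[+ _ _] Rxy]; apply.
  - move=> x y y' [R FR Rxy] [S FS Sxy].
    have [RS|SR] := Ftot _ _ FR FS.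
      by have [_ Sf _] := FP _ FS; apply: Sf (RS _ Rxy) Sxy.
    by have [_ Sf _] := FP _ FR; apply: Sf Rxy (SR _ Sxy).
  - move=> x x' y [R FR Rxy] [S FS Sxy].
    have [RS|SR] := Ftot _ _ FR FS.
      by have [_ _ Sf] := FP _ FS; apply: Sf (RS _ Rxy) Sxy.
    by have [_ _ Sf] := FP _ FR; apply: Sf Rxy (SR _ Sxy).
have [dom|/existsNP[a /not_implyP[Aa Na]]] :=
    pselect (forall x, A x -> exists y, R (x, y)).
  left; have [f fP] := choice_in dom; exists f.
  split; last by move=> _ [x /fP /RAC[_ ?] <-].
  move=> x y /set_mem /fP Rx /set_mem /fP Ry xy.
  by rewrite -xy in Ry; apply: Ri Rx Ry.
have [ran|/existsNP[c /not_implyP[Cc Nc]]] :=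
    pselect (forall y, C y -> exists x, R (x, y)).
  right; have [f fP] := choice_in ran; exists f.
  split; last by move=> _ [x /fP /RAC[? _] <-].
  move=> x y /set_mem /fP Rx /set_mem /fP Ry xy.
  by rewrite -xy in Ry; apply: Rf Rx Ry.
exfalso; apply: (Rmax (R `|` [set (a, c)])).
  split; first by move=> z; left.
  by move=> /(_ (a, c)) RR; apply: Na; exists c; apply: RR; right.
split.
- by move=> x y [/RAC//|[-> ->]].
- move=> x y y' [Rxy|[xa yc]] [Rxy'|[xa' yc']].
  + exact: Rf Rxy Rxy'.
  + by case: Na; exists y; rewrite -xa'.
  + by case: Na; exists y'; rewrite -xa.
  + by rewrite yc.
- move=> x x' y [Rxy|[xa yc]] [Rxy'|[xa' yc']].
  + exact: Ri Rxy Rxy'.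
  + by case: Nc; exists x; rewrite -yc'.
  + by case: Nc; exists x'; rewrite -yc.
  + by rewrite xa.
Qed.

(** Zorn's lemma gives a maximal graph [S] of an injective pairing on some
    domain [A] containing a copy of [nat].  If the complement of [A] injects into
    [A], two disjoint copies of [A] suffice to embed [X] into [A], and the pairing
    of [A] becomes one of [X].  Otherwise the complement contains a copy [B] of
    [A], and [S] extends to [A] and [B] together by sending the new pairs into
    [B], against maximality. *)
Lemma embeds_square (X : Type) : embeds nat X -> embeds (X * X) X.
Proof.
move=> [e eI].
pose dom (S : set (X * X * X)) := [set x | exists y z, S (x, y, z)].
pose Q (S : set (X * X * X)) :=
  [/\ forall x y z, S (x, y, z) -> dom S y /\ dom S z,
      forall x y, dom S x -> dom S y -> exists z, S (x, y, z) &
      forall x y x' y' z, S (x, y, z) -> S (x', y', z) -> x = x' /\ y = y'].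
(* S0 is the pairing transported from nat; forcing S0 into every graph keeps
   the domains infinite. *)
pose S0 := [set (e ij.1, e ij.2, e (pickle ij)) | ij in [set: nat * nat]].
have QS0 : Q S0.
  split.
  - move=> x y z [[i j] _ [_ <- <-]] /=.
    split.
      by exists (e j), (e (pickle (j, j))), (j, j).
    by exists (e 0), (e (pickle (pickle (i, j), 0))), (pickle (i, j), 0).
  - move=> x y [? [? [[i ?] _ [<- _ _]]]] [? [? [[j ?] _ [<- _ _]]]] /=.
    by exists (e (pickle (i, j))), (i, j).
  - move=> _ _ x' y' z [[i j] _ [<- <- <-]] /= [[i' j'] _ [<- <- /eI]].
    by move=> /(pcan_inj pickleK)[-> ->].
have [F FP Ftot|R [QR Rmax]] := @Zorn_bigcup _ [set R | Q (R `|` S0)].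
  have sub R : F R -> R `|` S0 `<=` \bigcup_(X in F) X `|` S0.
    by move=> FR z [Rz|?]; [left; exists R|right].
  have Fmem u v : (\bigcup_(X in F) X `|` S0) u ->
      (\bigcup_(X in F) X `|` S0) v ->
      exists R, [/\ Q R, R `<=` \bigcup_(X in F) X `|` S0, R u & R v].
    move=> [[R FR Ru]|Su] [[R' FR' Rv]|Sv].
    + have [RS|SR] := Ftot _ _ FR FR'.
        by exists (R' `|` S0); split; [exact: FP|exact: sub|left; apply: RS|left].
      by exists (R `|` S0); split; [exact: FP|exact: sub|left|left; apply: SR].
    + by exists (R `|` S0); split; [exact: FP|exact: sub|left|right].
    + by exists (R' `|` S0); split; [exact: FP|exact: sub|right|left].
    + by exists S0; split.
  have domS R R' x : R `<=` R' -> dom R x -> dom R' x.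
    by move=> RR' [y [z Rz]]; exists y, z; apply: RR'.
  split.
  - move=> x y z Uu; have [R [QR RU Ru _]] := Fmem _ _ Uu Uu.
    by case: QR => /(_ _ _ _ Ru)[dy dz] _ _; split; apply: domS RU _.
  - move=> x y [x1 [x2 Ux]] [y1 [y2 Uy]].
    have [R [[_ Rt _] RU Rx Ry]] := Fmem _ _ Ux Uy.
    have [||z Rz] := Rt x y; [by exists x1, x2|by exists y1, y2|].
    by exists z; apply: RU.
  - move=> x y x' y' z U1 U2; have [R [[_ _ Ri] RU R1 R2]] := Fmem _ _ U1 U2.
    exact: Ri R1 R2.
pose S := R `|` S0.
have [QS S0S Smax] : [/\ Q S, S0 `<=` S &
    forall S', Q S' -> S `<=` S' -> S' `<=` S].
  split=> //; first by right.
  move=> S' QS' SS'; apply: contrapT => S'S; apply: (Rmax S').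
    split; first by move=> z Rz; apply: SS'; left.
    by move=> S'R; apply: S'S => z /S'R; left.
  rewrite /= (_ : S' `|` S0 = S')//; apply/setUidl => z Sz; apply: SS'; right => //.
case: QS => Scl Stot Sinj; pose A := dom S.
have eA n : A (e n).
  by exists (e n), (e (pickle (n, n))); apply: S0S; exists (n, n).
have [h hS] : exists h, forall x y, A x -> A y -> S (x, y, h x y).
  have [|h hS] := @boolp.choice (X * X) X
      (fun p z => A p.1 -> A p.2 -> S (p, z)); last first.
    by exists (fun x y => h (x, y)) => x y; apply: (hS (x, y)).
  move=> [x y]; have [[Ax Ay]|Axy] := pselect (A x /\ A y).
    by have [z Sz] := Stot _ _ Ax Ay; exists z.
  by exists x => /= Ax Ay; case: Axy.
have hA x y : A x -> A y -> A (h x y).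
  by move=> Ax Ay; have [_] := Scl _ _ _ (hS _ _ Ax Ay).
have hI x y x' y' : A x -> A y -> A x' -> A y' ->
    h x y = h x' y' -> x = x' /\ y = y'.
  move=> Ax Ay Ax' Ay' hh; apply: Sinj (hS _ _ Ax Ay) _.
  by rewrite hh; apply: hS.
have e01 : e 0 <> e 1 by move=> /eI.
have [[k [kI kA]]|[k [kI kC]]] := card_comparable (~` A) A.
  (* The first components e 0 and e 1 tell the two cases apart. *)
  pose j x := if pselect (A x) then h (e 0) x else h (e 1) (k x).
  have jA x : A (j x).
    rewrite /j; case: pselect => Ax; apply: hA => //.
    by apply: kA; exists x.
  have jI : injective j.
    move=> x y; rewrite /j; case: pselect => Ax; case: pselect => Ay.
    + by move=> /hI[].
    + by move=> /hI[]//; apply: kA; exists y.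
    + by move=> /hI[]//; [apply: kA; exists x|move=> /esym].
    + move=> /hI[]//; [by apply: kA; exists x|by apply: kA; exists y|].
      by move=> _; apply: kI; rewrite inE.
  exists (fun p => h (j p.1) (j p.2)) => -[x y] [x' y'] /= /hI[]//.
  by move=> /jI -> /jI ->.
exfalso.
pose B := k @` A.
have [kinv kinvP] : exists kinv, forall y, B y -> A (kinv y) /\ k (kinv y) = y.
  by apply: (@choice_in X B (fun y x => A x /\ k x = y)) => y [x Ax kx]; exists x.
have BA y : B y -> ~ A y by move=> By; apply: kC.
pose j x := if pselect (A x) then h (e 0) x else h (e 1) (kinv x).
have jA x : (A `|` B) x -> A (j x).
  rewrite /j; case: pselect => // Ax; first by move=> _; apply: hA.
  by move=> []// /kinvP[? _]; apply: hA.
have jI x y : (A `|` B) x -> (A `|` B) y -> j x = j y -> x = y.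
  rewrite /j; case: pselect => Ax; case: pselect => Ay.
  + by move=> _ _ /hI[].
  + by move=> _ []// /kinvP[? _] /hI[].
  + by move=> []// /kinvP[? _] _ /hI[]// /esym.
  + move=> []// /kinvP[? kx] []// /kinvP[? ky] /hI[]// _ kk.
    by rewrite -kx -ky kk.
(* N consists of the new pairs, with values in the copy B of A. *)
pose N := [set u : X * X * X | [/\ (A `|` B) u.1.1, (A `|` B) u.1.2,
  ~ (A u.1.1 /\ A u.1.2) & u.2 = k (h (j u.1.1) (j u.1.2))]].
have dom' x : (A `|` B) x -> dom (S `|` N) x.
  move=> ABx; have [Ax|Ax] := pselect (A x).
    by case: Ax => [y [z Sz]]; exists y, z; left.
  exists x, (k (h (j x) (j x))); right; split=> //=; tauto.
have domE x : dom (S `|` N) x -> (A `|` B) x.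
  by move=> [y [z [Sz|[]//]]]; left; exists y, z.
have NB u : N u -> B u.2.
  case: u => [[x y] z] [/= ABx ABy _ ->]; exists (h (j x) (j y)) => //.
  by apply: hA; apply: jA.
have /Smax/(_ _)/(_ (k (e 0), k (e 0), k (h (j (k (e 0))) (j (k (e 0))))))SN : Q (S `|` N).
  split.
  - move=> x y z [/Scl[Ay Az]|Nu]; first by split; apply: dom'; left.
    by split; apply: dom'; [case: Nu|right; apply: (NB _ Nu)].
  - move=> x y /domE ABx /domE ABy.
    have [[Ax Ay]|Axy] := pselect (A x /\ A y).
      by have [z Sz] := Stot _ _ Ax Ay; exists z; left.
    by exists (k (h (j x) (j y))); right.
  - move=> x y x' y' z [Su|Nu] [Su'|Nu'].
    + exact: Sinj Su Su'.
    + by case: (BA _ (NB _ Nu')); have [] := Scl _ _ _ Su.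
    + by case: (BA _ (NB _ Nu)); have [] := Scl _ _ _ Su'.
    + case: Nu => /= ABx ABy _ zE; case: Nu' => /= ABx' ABy' _.
      have hm u v : (A `|` B) u -> (A `|` B) v -> h (j u) (j v) \in A.
        by move=> ABu ABv; rewrite inE; apply: hA; apply: jA.
      rewrite zE => /(kI _ _ (hm _ _ ABx ABy) (hm _ _ ABx' ABy')).
      by move=> /hI[]; try exact: jA; move=> /jI -> // /jI ->.
have Bk0 : B (k (e 0)) by exists (e 0).
have : S (k (e 0), k (e 0), k (h (j (k (e 0))) (j (k (e 0))))).
  apply: SN; first by move=> z; left.
  by right; split=> /=; [right|right|move=> [/BA]|].
by move=> Sk; apply: (BA _ Bk0); exists (k (e 0)), (k (h (j (k (e 0))) (j (k (e 0))))).
Qed.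

Section Absorption.
Variables (Y : Type) (Yinf : embeds nat Y).

Lemma countable_embeds (Q : countType) : embeds Q Y.
Proof. exact: embedsT (embeds_count Q) Yinf. Qed.

Lemma embeds_prod X Z : embeds X Y -> embeds Z Y -> embeds (X * Z) Y.
Proof.
move=> [f fI] [g gI]; have [p pI] := embeds_square Yinf.
exists (fun u => p (f u.1, g u.2)) => -[x z] [x' z'] /pI[/fI -> /gI ->] //.
Qed.

Lemma embeds_sum X Z : embeds X Y -> embeds Z Y -> embeds (X + Z) Y.
Proof.
move=> eX eZ; apply: (@embedsT (bool * Y)); last first.
  by apply: embeds_prod; [exact: countable_embeds|exists id].
move: eX eZ => [f fI] [g gI].
exists (fun u => match u with inl x => (true, f x) | inr z => (false, g z) end).
by move=> [x|z] [x'|z'] // [] => [/fI|/gI] ->.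
Qed.

(** A sequence is recovered from its length and an iterated pairing of its
    entries; the length tells where the decoding stops. *)
Lemma embeds_seq X : embeds X Y -> embeds (seq X) Y.
Proof.
move=> [f fI]; have [p pI] := embeds_square Yinf; have [e eI] := Yinf.
pose c := foldr (fun x y => p (f x, y)) (e 0).
have [//|q qI] := embeds_prod (X := nat) (Z := Y) Yinf; first by exists id.
exists (fun s => q (size s, c s)) => s s' /qI[].
elim: s s' => [|x s IH] [|x' s']//= [ss'] /pI[/fI -> cc].
by rewrite (IH s').
Qed.

End Absorption.

Lemma cantor_uncountable : ~ embeds cantor_space nat.
Proof.
move=> [f fI].
pose diag : cantor_space := fun n => ~~ `[< exists2 z : cantor_space, f z = n & z n >].
have := erefl (diag (f diag)); rewrite {1}/diag.
case: asboolP => [[z /fI -> ->]//|N /= /esym dd].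
by case: N; exists diag.
Qed.

(** If [X] is infinite it absorbs the summand [nat]; if it is finite the sum is
    countable, which the Cantor space is not. *)
Lemma cantor_embeds_sum (X : Type) :
  embeds cantor_space (nat + X) -> embeds cantor_space X.
Proof.
move=> cX; have [/finite_set_countable|/infiniteP] := pselect (finite_set [set: X]).
  move=> /card_leTE eX; exfalso; apply/cantor_uncountable/(embedsT cX).
  by apply: embeds_sum => //; exists id.
move=> /card_leTE Xinf; apply: (embedsT cX).
by apply: embeds_sum => //; exists id.
Qed.

(** Take any well-order.  If some initial segment has the size of [W], pull the
    order back along an injection of [W] into the least such segment: its own
    initial segments are too small by minimality. *)
Lemma small_well_order (W : eqType) : exists le : rel W,
  [/\ total le, transitive le, antisymmetric le,
      well_founded (fun x y => le x y && (x != y)) &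
      forall a, ~ embeds W {b | le b a && (b != a)} ].
Proof.
have [le lewo] := wochoice.well_ordering_principle W.
have leT : wochoice.wo_chain le predT by move=> A _; apply: lewo.
have let_ : total le by move=> x y; apply: (wochoice.wo_chainW leT).
have lea : antisymmetric le by move=> x y; apply: (wochoice.wo_chain_antisymmetric leT).
have lemin (P : W -> Prop) : (exists x, P x) -> exists2 x, P x & forall y, P y -> le x y.
  move=> [x Px]; have [|z [[Pz zmin] _]] := lewo (fun x => `[< P x >]).
    by exists x; apply/asboolP.
  by exists z; [apply/asboolP|move=> y Py; apply: zmin; apply/asboolP].
have letr : transitive le.
  move=> y x z xy yz.
  have [|m [->|[->|->]] mmin] := lemin (fun u => u = x \/ u = y \/ u = z); first by exists x; left.
  - by apply: mmin; right; right.
  - have yx : le y x by apply: mmin; left.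
    by rewrite (lea x y)// xy.
  - have zy : le z y by apply: mmin; right; left.
    by rewrite -(lea y z)// yz.
have wf : well_founded (fun x y => le x y && (x != y)).
  move=> a; apply: contrapT => Na.
  have [|x Nx xmin] := lemin (fun u => ~ Acc (fun x y => le x y && (x != y)) u); first by exists a.
  apply: Nx; constructor=> y /andP[yx nyx]; apply: contrapT => Ny.
  by move/negP: nyx; apply; apply/eqP/lea; rewrite yx xmin.
have [exW|N] := pselect (exists a, embeds W {b | le b a && (b != a)}); last first.
  by exists le; split=> // a aW; apply: N; exists a.
have [x0 [f fI] x0min] := lemin _ exW.
pose g y := sval (f y).
have gI : injective g by move=> x y /val_inj /fI.
exists (relpre g le); split.
- by move=> x y; apply: let_.
- by move=> y x z; apply: letr.
- by move=> x y /lea /gI.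
- move=> a; move E : (g a) => u; elim: (wf u) a E => {}u _ IH a E.
  constructor=> y /andP[ya nya]; apply: (IH (g y)) => //.
  by rewrite -E (inj_eq gI) nya andbT.
- move=> a aW.
  have /andP[lea0 nea0] : le (g a) x0 && (g a != x0) := svalP (f a).
  move/negP: nea0; apply; apply/eqP/lea; rewrite lea0 /=; apply: x0min.
  apply: (embedsT aW).
  have gP (u : {b | relpre g le b a && (b != a)}) :
      le (g (sval u)) (g a) && (g (sval u) != g a).
    by rewrite (inj_eq gI); exact: svalP u.
  exists (fun u => exist _ (g (sval u)) (gP u)) => u v [/gI uv].
  exact: val_inj.
Qed.

(** Transfinite recursion for a specification [P a y g] of the value [g] at [a],
    in terms of the values [y] chosen below [a]. *)
Lemma well_founded_choice (W X : Type) (lt : rel W)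
    (P : forall a, ({b | lt b a} -> X) -> X -> Prop) :
  well_founded lt -> (forall a y, exists g, P a y g) ->
  exists x : W -> X, forall a, P a (fun b => x (sval b)) (x a).
Proof.
move=> wf PE.
pose step a (rec : forall b, lt b a -> X) : X :=
  sval (cid (PE a (fun b => rec (sval b) (svalP b)))).
exists (Fix wf (fun=> X) step) => a.
rewrite Fix_eq; last first.
  move=> b r r' rr'; rewrite /step; suff -> : r = r' by [].
  by apply: functional_extensionality_dep => u; apply: functional_extensionality_dep.
exact: (svalP (cid (PE a (fun b => Fix wf (fun=> X) step (sval b))))).
Qed.

(** * Baire category in compact Hausdorff spaces *)

Section CompactHausdorff.
Context {T : topologicalType}.
Hypotheses (Tcompact : compact [set: T]) (Thausdorff : hausdorff_space T).

(** The quasi-component [Q] of [x], the intersection of its clopen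
    neighbourhoods, is connected in a compact Hausdorff space, so it is reduced
    to [x].  Indeed, let [E] split [Q] into two closed pieces.  By normality an
    open [W] separates them, and by compactness some clopen [C] around [x]
    misses the boundary of [W]; then [C] cut by [W], or by its complement, is
    clopen around [x] and misses one of the pieces. *)
Lemma totally_disconnected_zero_dimensional :
  totally_disconnected [set: T] -> zero_dimensional T.
Proof.
move=> Ttd x y xy; apply: contrapT => Nxy.
pose Q := [set z | forall U : set T, clopen U -> U x -> U z].
have Qx : Q x by move=> U _.
have Qcl : closed Q.
  have -> : Q = \bigcap_(U in [set U : set T | clopen U /\ U x]) U.
    apply/seteqP; split; move=> z Qz U.
      by move=> [cU Ux]; apply: Qz.
    by move=> cU Ux; apply: Qz.
  by apply: closed_bigI => U [[]].
suff Qconn : connected Q.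
  have : connected_component [set: T] x y.
    exists Q => // U cU Ux; apply: contrapT => Uy.
    by apply: Nxy; exists U.
  by rewrite Ttd// => /= yx; move/eqP: xy; rewrite yx.
apply/connectedP => E [En0 QE [E01 E10]].
have EQ b : E b `<=` Q by rewrite QE => z Ez; case: b Ez; [right|left].
have Ecl b : closed (E b).
  rewrite closure_id; apply/seteqP; split; first exact: subset_closure.
  move=> z clz; have : Q z.
    by have /closure_id -> := Qcl; apply: closure_subset clz; exact: EQ.
  rewrite {1}QE => -[] Ez; case: b clz => // clz; exfalso.
    by have : (E false `&` closure (E true)) z by []; rewrite E10.
  by have : (closure (E false) `&` E true) z by []; rewrite E01.
have [] := @compact_normal T Thausdorff Tcompact (E false) (Ecl false) (~` E true).
  move=> z Ez; apply: open_nbhs_nbhs; split; first exact/closed_openC.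
  move=> Etz; have : (E false `&` closure (E true)) z.
    by split=> //; exact: subset_closure.
  by rewrite E10.
move=> N EN NE; pose W := N°.
have oW : open W by exact: open_interior.
have EW : E false `<=` W by move=> z /EN.
have WE : closure W `<=` ~` E true.
  by apply: subset_trans NE; apply: closure_subset; exact: interior_subset.
(* K is the boundary of W. *)
pose K := closure W `\` W.
have Kcl : closed K.
  by rewrite /K setDE; apply: closedI; [exact: closed_closure|exact: open_closedC].
have Kc : compact K by apply: subclosed_compact Kcl Tcompact _.
have KQ : K `&` Q = set0.
  apply/seteqP; split=> // z [[clWz Wz]]; rewrite QE => -[/EW//|].
  exact: WE.
have [C [[oC cC] Cx CK]] : exists C, [/\ clopen C, C x & C `&` K = set0].
  apply: contrapT => NC.
  pose F := filter_from [set C : set T | clopen C /\ C x] (fun C => C `&` K).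
  have FF : ProperFilter F.
    apply: filter_from_proper.
      apply: filter_from_filter; first by exists setT; split=> //; exact: clopenT.
      move=> C C' [cC Cx] [cC' C'x]; exists (C `&` C'); first by split=> //; exact: clopenI.
      by move=> z [[? ?] ?].
    move=> C [cC Cx]; apply/set0P/eqP => CK; apply: NC; by exists C.
  have [|p [Kp clp]] := Kc F FF.
    by exists setT; [split=> //; exact: clopenT|move=> z []].
  have : (K `&` Q) p.
    split=> // U [oU cU] Ux; apply: (cU) => B Bp.
    have [|z [[Uz _] Bz]] := clp (U `&` K) B _ Bp; first by exists U.
    by exists z.
  by rewrite KQ.
have CW : C `&` closure W = C `&` W.
  apply/seteqP; split=> z [Cz Wz]; split=> //; last exact: subset_closure.
  apply: contrapT => NWz; have : (C `&` K) z by [].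
  by rewrite CK.
have [Wx|NWx] := pselect (W x).
  have [z Ez] := En0 true.
  have CWclopen : clopen (C `&` W).
    split; first exact: openI.
    by rewrite -CW; apply: closedI => //; exact: closed_closure.
  have [_ /(@subset_closure _ W)/WE] := EQ _ _ Ez _ CWclopen (conj Cx Wx).
  by apply.
have [z Ez] := En0 false.
have CWclopen : clopen (C `&` ~` W).
  split; last by apply: closedI => //; exact: open_closedC.
  have -> : C `&` ~` W = C `&` ~` closure W.
    apply/seteqP; split=> u [Cu Wu]; split=> //.
      by move=> clu; have : (C `&` closure W) u by []; rewrite CW => -[].
    by move=> Wu'; apply: Wu; exact: subset_closure.
  by apply: openI => //; apply: closed_openC; exact: closed_closure.
have [_] := EQ _ _ Ez _ CWclopen (conj Cx NWx).
by apply; exact: EW.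
Qed.

End CompactHausdorff.

Section Category.
Context {T : topologicalType}.
Implicit Types A B U : set T.

Lemma nowhere_dense_subset A B : A `<=` B -> nowhere_dense B -> nowhere_dense A.
Proof.
rewrite /nowhere_dense => AB B0; rewrite -subset0 -B0.
by move=> x; apply: filterS; exact: closure_subset.
Qed.

Lemma meager_subset A B : A `<=` B -> meager B -> meager A.
Proof.
move=> AB [F Fnd BF]; exists (fun k => F k `&` A).
  by move=> k; apply: nowhere_dense_subset (Fnd k) => x [].
by rewrite -setI_bigcupl -BF; apply/esym/setIidPr.
Qed.

Lemma nowhere_dense_meager A : nowhere_dense A -> meager A.
Proof. by move=> And; exists (fun=> A) => //; rewrite bigcup_const //; exists 0%N. Qed.

Lemma meagerU A B : meager A -> meager B -> meager (A `|` B).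
Proof.
move=> [F Fnd ->] [E End ->].
exists (fun k => if odd k then F k./2 else E k./2).
  by move=> k; case: ifP.
apply/seteqP; split=> x.
  move=> [[k _ Fx]|[k _ Ex]].
    by exists k.*2.+1 => //=; rewrite odd_double /= uphalf_double.
  by exists k.*2 => //=; rewrite odd_double doubleK.
by move=> [k _]; case: ifP => _ ?; [left|right]; exists k./2.
Qed.

Lemma nowhere_dense_closedP A : closed A ->
  (forall U, open U -> U `<=` A -> U = set0) -> nowhere_dense A.
Proof.
move=> /closure_id clA H; rewrite /nowhere_dense -clA; apply: H.
  exact: open_interior.
exact: interior_subset.
Qed.

(** Regularity yields a decreasing sequence of nonempty open sets [V n] with the
    closure of [V n.+1] inside [V n] and [V n.+1] disjoint from the [n]-th nowhere
    dense set; compactness gives a point in all of them. *)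
Lemma Baire_compact U : compact [set: T] -> hausdorff_space T ->
  open U -> U !=set0 -> ~ meager U.
Proof.
move=> Tc Th oU U0 [F Fnd UF].
pose good (V : set T) := open V /\ V !=set0.
have [|next nextP] := @boolp.choice (nat * set T) (set T) (fun p V' => good p.2 ->
    [/\ good V', closure V' `<=` p.2 & V' `&` F p.1 = set0]); last first.
  pose V := fix V n := if n is m.+1 then next (m, V m) else U.
  have Vgood n : good (V n).
    by elim: n => [|n IH] //=; have [] := nextP (n, V n) IH.
  have Vcl n : closure (V n.+1) `<=` V n by have [] := nextP (n, V n) (Vgood n).
  have VF n : V n.+1 `&` F n = set0 by have [] := nextP (n, V n) (Vgood n).
  have Vmono m n : (m <= n)%N -> V n `<=` V m.
    elim: n => [|n IH]; first by rewrite leqn0 => /eqP ->.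
    rewrite leq_eqVlt => /predU1P[-> //|]; rewrite ltnS => /IH.
    apply: subset_trans; apply: subset_trans (Vcl n); exact: subset_closure.
  have FF : ProperFilter (filter_from [set: nat] V).
    apply: filter_from_proper; last by move=> n _; have [] := Vgood n.
    apply: filter_from_filter; first by exists 0%N.
    move=> m n _ _; exists (maxn m n) => //.
    by move=> z Vz; split; apply: Vmono Vz; rewrite (leq_maxl, leq_maxr).
  have [|p [_ clp]] := Tc _ FF; first exact: filterT.
  have Vp n : V n p.
    by apply: Vcl => B Bp; apply: clp => //; exists n.+1.
  have : U p by exact: (Vp 0%N).
  rewrite UF => -[n _ Fp]; have : (V n.+1 `&` F n) p by [].
  by rewrite VF.
move=> [n W]; have [gW|NgW] := pselect (good W); last by exists set0.
case: (gW) => oW [w Ww].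
have [x [Wx Fx]] : exists x, W x /\ ~ closure (F n) x.
  apply: contrapT => NN.
  have : (closure (F n))° w.
    rewrite /interior; apply: filterS (open_nbhs_nbhs (conj oW Ww)) => z Wz.
    by apply: contrapT => Fz; apply: NN; exists z.
  by rewrite Fnd.
have nbx : nbhs x (W `&` ~` closure (F n)).
  apply: filterI; first by apply: open_nbhs_nbhs.
  apply: open_nbhs_nbhs; split=> //; apply: closed_openC; exact: closed_closure.
have [N Nx NW] := compact_regular Th Tc filterT nbx.
exists (N°) => _; split.
- by split; [exact: open_interior|exists x].
- move=> z /(closure_subset (@interior_subset _ N)) /NW [] //.
- rewrite -subset0 => z [/(@interior_subset _ N) /(@subset_closure _ N) /NW[_] Fz].
  by move=> /(@subset_closure _ (F n)).
Qed.

End Category.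

(** Openness of [f] sends an open set inside the closure of the preimage to an
    open set inside the closure of [A]. *)
Lemma nowhere_dense_preimage (S T : topologicalType) (f : S -> T) (A : set T) :
  continuous f -> (forall U, open U -> open (f @` U)) ->
  nowhere_dense A -> nowhere_dense (f @^-1` A).
Proof.
move=> fc fo And; rewrite /nowhere_dense -subset0 => x xcl.
have clf : closure (f @^-1` A) `<=` f @^-1` (closure A).
  have fcl : closed (f @^-1` (closure A)).
    by apply: closed_comp; [move=> ? _; exact: fc|exact: closed_closure].
  rewrite (iffLR (closure_id _) fcl); apply: closure_subset.
  by apply: preimage_subset; exact: subset_closure.
have : (closure A)° (f x).
  rewrite /interior.
  have := fo _ (open_interior (closure (f @^-1` A))).
  move=> oU; apply: filterS (open_nbhs_nbhs (conj oU _)); last by exists x.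
  by move=> _ [z /(@interior_subset _ _) /clf zA <-].
by rewrite And.
Qed.

Lemma meager_preimage (S T : topologicalType) (f : S -> T) (A : set T) :
  continuous f -> (forall U, open U -> open (f @` U)) ->
  meager A -> meager (f @^-1` A).
Proof.
move=> fc fo [F Fnd ->]; exists (fun k => f @^-1` F k).
  by move=> k; exact: nowhere_dense_preimage.
by rewrite preimage_bigcup.
Qed.

(** * Compact metrizable spaces and dense sets *)

Section Metrizable.
Variables (R : realType) (T : topologicalType) (t0 : T).
Hypothesis Tmetr : metrizable R T.

(** The distance equips [T] with a uniform structure inducing the given
    topology, which gives access to the theory of compact pseudometric spaces,
    and in particular to the characterization of the Cantor space by Brouwer. *)
Lemma metrizable_compact : compact [set: T] ->
  second_countable (T := T) /\
  (cantor_like T -> exists f : cantor_space -> T,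
    [/\ bijective f, continuous f & forall A, closed A -> closed (f @` A)]).
Proof.
have [d [d0 dC dT dN]] := Tmetr.
have dxx x : d x x = 0%R by apply/d0.
pose ball (x : T) (e : R) : set T := [set y | (d x y < e)%R].
pose ent : set_system (T * T) := entourage_ ball.
have ballc x (e : R) : (0 < e)%R -> ball x e x by rewrite /ball /= dxx.
have balls x y (e : R) : ball x e y -> ball y e x by rewrite /ball /= dC.
have ballt x y z (e1 e2 : R) : ball x e1 y -> ball y e2 z -> ball x (e1 + e2)%R z.
  by rewrite /ball /= => xy yz; apply: le_lt_trans (dT x y z) _; apply: ltrD.
have entF : Filter ent.
  apply: filter_from_filter; first by exists 1%R => /=.
  move=> e1 e2 /= e10 e20; exists (Num.min e1 e2); first by rewrite /= lt_min e10.
  by move=> [x y]; rewrite /ball /= lt_min => /andP[].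
have entD A : ent A -> diagonal `<=` A.
  by move=> [e e0 eA] [x y]; rewrite /diagonal /= => ->; apply: eA; apply: ballc.
have entV A : ent A -> ent (A^-1)%relation.
  by move=> [e e0 eA]; exists e => // -[x y] /= /balls xy; apply: eA.
have entS A : ent A -> exists2 B, ent B & (B \; B `<=` A)%relation.
  move=> [e e0 eA]; exists [set xy | ball xy.1 (e / 2)%R xy.2].
    by exists (e / 2)%R => //=; rewrite divr_gt0.
  move=> [x y] [z /= xz zy]; apply: eA => /=; rewrite [e]splitr; exact: ballt xz zy.
have nE : nbhs = nbhs_ ent.
  apply/funext => x; apply/funext => A; apply/propext; rewrite dN nbhs_E; split.
    move=> [e e0 eA]; exists [set xy | ball xy.1 e xy.2]; first by exists e.
    by move=> y /xsectionP; apply: eA.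
  move=> [B [e e0 eB] BA]; exists e => // y xy; apply: BA; apply/xsectionP.
  exact: eB.
(* The topology of T is kept, so open sets of M are those of T by conversion. *)
pose U : uniformType := HB.pack_for uniformType T
  (Nbhs_isUniform_mixin.Build T entF entD entV entS nE).
pose M : pseudoPMetricType R := HB.pack_for (pseudoPMetricType R) U
  (isPointed.Build U t0)
  (@Uniform_isPseudoMetric.Build R U ball ballc balls ballt erefl).
move=> Tc; split; first exact: (@compact_second_countable R M Tc).
move=> Tcl; have [f [fc fcl]] := @homeomorphism_cantor_like R M Tcl.
exists f; split=> //; rewrite -setTT_bijective; exact: bij.
Qed.

End Metrizable.

Lemma second_countable_seq (T : topologicalType) : second_countable (T := T) ->
  exists b : nat -> set T, forall x (U : set T), nbhs x U ->
    exists2 n, b n `<=` U & b n x.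
Proof.
move=> [B /countable_injP[f fI] [_ Bb]].
exists (fun n => if pselect (exists2 U, B U & f U = n) is left e then s2val (cid2 e) else setT).
move=> x U /Bb[V [BV Vx] VU]; exists (f V); case: pselect => [e|[]].
- rewrite (_ : s2val (cid2 e) = V)//.
  by apply: fI; rewrite ?inE//; [exact: s2valP|exact: (s2valP' (cid2 e))].
- by exists V.
- rewrite (_ : s2val (cid2 e) = V)//.
  by apply: fI; rewrite ?inE//; [exact: s2valP|exact: (s2valP' (cid2 e))].
- by exists V.
Qed.

(** With [b] a basis, an element of the Cantor space encodes a sequence of sets of
    indices, hence a sequence of open sets, hence the union of their
    complements.  All unions of sequences of closed sets arise so. *)
Definition coded_Fsigma (T : Type) (b : nat -> set T) (e : cantor_space) : set T :=
  \bigcup_k ~` \bigcup_(n in [set n | e (pickle (k : nat, n : nat))]) b n.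

Lemma coded_FsigmaE (T : topologicalType) (b : nat -> set T) (C : nat -> set T) :
  (forall x (U : set T), nbhs x U -> exists2 n, b n `<=` U & b n x) ->
  (forall k, closed (C k)) -> exists e, \bigcup_k C k = coded_Fsigma b e.
Proof.
move=> bb Ccl.
exists (fun m : nat => if unpickle m is Some (k, n) then `[< b n `<=` ~` C k >] else false).
apply: eq_bigcupr => k _; rewrite -[LHS]setCK; congr (~` _).
apply/seteqP; split=> x.
  move=> Ckx; have [|n bC bx] := bb x (~` C k).
    by apply: open_nbhs_nbhs; split=> //; exact: closed_openC.
  by exists n => //=; rewrite pickleK; apply/asboolP.
by move=> [n /=]; rewrite pickleK => /asboolP bC /bC.
Qed.

(** The coordinates of a point of [O] are moved into [D] one after the other,
    without leaving [O]. *)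
Lemma dense_fpow (T : topologicalType) (D : set T) n (O : set (fpow T n)) :
  (forall U : set T, open U -> U !=set0 -> exists2 x, U x & D x) ->
  open O -> O !=set0 -> exists2 h, O h & forall i, D (h i).
Proof.
move=> Dd oO [h0 Oh0].
suff ODk k : (k <= n)%N -> exists2 h, O h & forall i : 'I_n, (i < k)%N -> D (h i).
  by have [h Oh hD] := ODk n (leqnn n); exists h => // i; apply: hD.
elim: k => [_|k IH kn]; first by exists h0.
have [h Oh hD] := IH (ltnW kn).
pose i := Ordinal kn.
have cont := @dfwith_continuous 'I_n (fun=> T) h i.
have [||z Oz Dz] := Dd (dfwith h i @^-1` O).
- by apply: (@open_comp T (fpow T n) (dfwith h i)) => // ? _; exact: cont.
- exists (h i); rewrite /preimage /= (_ : dfwith h i (h i) = h)//.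
  by apply/funext => j; case: dfwithP.
exists (dfwith h i z) => // j; rewrite ltnS leq_eqVlt => /orP[/eqP ji|jk].
  have -> : j = i by apply: val_inj.
  by rewrite dfwithin.
rewrite dfwithout; first exact: hD.
by apply/eqP => /(congr1 val) /= ij; rewrite -ij ltnn in jk.
Qed.

(** * Generated subgroups and coded words *)

Section Generation.
Context {G : groupType}.

Definition signed (b : bool) (g : G) : G := if b then g else (g^-1)%g.

Lemma signedV b g : ((signed b g)^-1)%g = signed (~~ b) g.
Proof. by case: b => //=; rewrite invgK. Qed.

Definition generated (I : Type) (f : I -> G) : set G :=
  range (fun l : seq (I * bool) => \prod_(p <- l) signed p.2 (f p.1))%g.

Lemma generated_subgroup (I : Type) (f : I -> G) : subgroup (generated f).
Proof.
split.
- by exists [::] => //; rewrite big_nil.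
- by move=> _ _ [l _ <-] [l' _ <-]; exists (l ++ l') => //; rewrite big_cat.
- move=> _ [l _ <-]; elim: l => [|[i b] l [l' _ IH]].
    by exists [::] => //; rewrite !big_nil invg1.
  exists (rcons l' (i, ~~ b)) => //.
  by rewrite big_rcons/= IH big_cons/= invgM signedV.
Qed.

Lemma generated_gen (I : Type) (f : I -> G) i : generated f (f i).
Proof. by exists [:: (i, true)] => //; rewrite big_seq1. Qed.

Lemma subgroup_signed (H : set G) b g : subgroup H -> H g -> H (signed b g).
Proof. by case: b => -[_ _ HV] //= Hg; apply: HV. Qed.

Lemma subgroup_prod (H : set G) (I : eqType) (r : seq I) (F : I -> G) : subgroup H ->
  (forall i, i \in r -> H (F i)) -> H (\prod_(i <- r) F i)%g.
Proof.
move=> [H1 HM _] HF; rewrite big_seq; elim/big_ind : _ => //.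
Qed.

(** Words are handled through sequences of symbols, where a symbol is a signed
    variable or a signed index of a constant.  Unlike letters, symbols have
    decidable equality, do not depend on the group elements, and can be
    counted. *)
Section Symbols.
Variable J : Type.

Definition symbol : Type := (nat * bool + J * bool)%type.

Definition letter_of (f : J -> G) (q : symbol) : letter G :=
  match q with
  | inl (k, b) => if b then Var k else VarInv k
  | inr (j, b) => Const (signed b (f j))
  end.

Definition word_of (f : J -> G) (s : seq symbol) : word G := map (letter_of f) s.

Definition symbol_var (q : symbol) : option nat :=
  if q is inl (k, _) then Some k else None.

Definition symbol_vars (s : seq symbol) : seq nat :=
  sort leq (undup (pmap symbol_var s)).

Definition symbol_value (f : J -> G) (v : nat -> G) (q : symbol) : G :=
  match q with inl (k, b) => signed b (v k) | inr (j, b) => signed b (f j) end.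

Definition eval_symbols (f : J -> G) (v : nat -> G) (s : seq symbol) : G :=
  (\prod_(q <- s) symbol_value f v q)%g.

Lemma word_vars_word_of f s : word_vars (word_of f s) = symbol_vars s.
Proof.
rewrite /word_vars /symbol_vars; congr (sort _ (undup _)).
by elim: s => //= -[[k []]|[j b]] s //= ->.
Qed.

Lemma word_eval_word_of f s n (h : 'I_n -> G) :
  word_eval (word_of f s) h = eval_symbols f (var_subst (word_of f s) h) s.
Proof.
rewrite /word_eval /eval_symbols big_map; apply: eq_bigr.
by move=> [[k []]|[j b]] _.
Qed.

Lemma symbol_vars_sorted s : sorted ltn (symbol_vars s).
Proof.
by rewrite ltn_sorted_uniq_leq sort_uniq undup_uniq sort_sorted//; exact: leq_total.
Qed.

End Symbols.

Lemma mem_symbol_vars (J : eqType) (s : seq (symbol J)) k :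
  (k \in symbol_vars s) = has (fun q => symbol_var q == Some k) s.
Proof.
rewrite mem_sort mem_undup; elim: s => [|q s IH] //=.
case: (symbol_var q) => [l|] //=; rewrite ?inE IH//.
by rewrite (inj_eq Some_inj) eq_sym.
Qed.

Section Substitution.
Variables (J : eqType) (f : J -> G).
Implicit Types (s : seq (symbol J)) (q : symbol J).

Lemma eq_eval_symbols (v v' : nat -> G) s :
  {in symbol_vars s, v =1 v'} -> eval_symbols f v s = eval_symbols f v' s.
Proof.
move=> vv'; rewrite /eval_symbols !big_seq; apply: eq_bigr => -[[k b]|[j b]] qs //=.
by rewrite vv'// mem_symbol_vars; apply/hasP; exists (inl (k, b)) => /=.
Qed.

Definition subst_symbol (k : nat) (j : J) (q : symbol J) : symbol J :=
  if q is inl (l, b) then if l == k then inr (j, b) else q else q.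

Definition subst_symbols k j s := map (subst_symbol k j) s.

Lemma eval_symbols_subst k j v s :
  eval_symbols f v (subst_symbols k j s) =
  eval_symbols f (fun l => if l == k then f j else v l) s.
Proof.
rewrite /eval_symbols big_map; apply: eq_bigr => -[[l b]|[i b]] _ //=.
by case: ifP.
Qed.

Lemma symbol_vars_subst k j s l :
  (l \in symbol_vars (subst_symbols k j s)) = (l \in symbol_vars s) && (l != k).
Proof.
rewrite !mem_symbol_vars has_map -[RHS]andbC; elim: s => [|q s IH] /=; first by rewrite andbF.
rewrite IH; case: q => [[i b]|[i b]] //=; case: (eqVneq i k) => [->|ik] /=.
  by rewrite (inj_eq Some_inj) eq_sym; case: eqVneq.
by rewrite (inj_eq Some_inj); case: (eqVneq i l) => [<-|]; rewrite ?ik ?orbT.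
Qed.

Lemma symbol_vars_subst_last k j s vs :
  symbol_vars s = rcons vs k -> symbol_vars (subst_symbols k j s) = vs.
Proof.
move=> sE; have vsS : sorted ltn (rcons vs k) by rewrite -sE symbol_vars_sorted.
have := vsS; rewrite ltn_sorted_uniq_leq rcons_uniq => /andP[/andP[kvs _] _].
apply: (irr_sorted_eq ltn_trans ltnn); first exact: symbol_vars_sorted.
  by move: vsS; rewrite -cats1 => /cat_sorted2[].
move=> l; rewrite symbol_vars_subst sE mem_rcons inE.
by case: eqVneq => [->|]; rewrite ?andbF ?andbT//; apply/esym/negbTE.
Qed.

End Substitution.

End Generation.

(** [c] lists the constants that are present from the start; [y] gives those
    chosen by recursion. *)
Definition constants (T X : Type) (c : nat -> T) (y : X -> T) (j : nat + X) : T :=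
  match j with inl n => c n | inr b => y b end.

(** * Exceptional sets of words *)

Section Exceptional.
Context {G : topologicalGroupType}.
Implicit Types w : word G.

Definition solutions (n : nat) w : set (fpow G n) :=
  [set h : fpow G n | word_eval w h = 1%g].

Arguments solutions : clear implicits.

Definition meager_word w :=
  (0 < word_arity w)%N /\ meager (solutions (word_arity w) w).

(** The Kuratowski-Ulam-Markov set attached to [w]: the values that must not be
    substituted for the last variable if the solutions are to stay meager, or,
    when [w] has one variable, if the result is to differ from 1. *)
Definition exceptional w : set G :=
  if word_arity w == 1%N then [set g | solutions 1 w (fun=> g)]
  else [set g | ~ meager (fiber (solutions (word_arity w).-1.+1 w) g)].

Lemma exceptional_KUM w : meager_word w -> KUM_set (exceptional w).
Proof.
rewrite /meager_word /exceptional; case wE : (word_arity w) => [|[|m]] [//= _ wm].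
  left; exists (solutions 1 w) => //; split=> //.
  by exists w; split; rewrite ?wE.
right; exists m.+1; exists (solutions m.+2 w) => //; split=> //; split=> //.
by exists w; split; rewrite ?wE.
Qed.

Lemma var_subst_nth (w : word G) n (h : 'I_n -> G) k (kn : (index k (word_vars w) < n)%N) :
  var_subst w h k = h (Ordinal kn).
Proof.
rewrite /var_subst; case: insubP => [j _ jE|]; last by rewrite kn.
by congr h; apply: val_inj.
Qed.

(** Fixing the last coordinate of a solution amounts to replacing the last
    variable by a constant, which keeps a fiber a Markov set with one variable
    fewer. *)
Lemma fiber_solutions (J : eqType) (f : J -> G) s k j vs (m : nat) :
  symbol_vars s = rcons vs k -> size vs = m ->
  fiber (solutions m.+1 (word_of f s)) (f j) =
  solutions m (word_of f (subst_symbols k j s)).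
Proof.
move=> sE vsm; rewrite /fiber /solutions; apply/funext => h /=; apply/propext.
rewrite !word_eval_word_of eval_symbols_subst.
suff -> : eval_symbols f (var_subst (word_of f s) (fpow_rcons h (f j))) s =
  eval_symbols f (fun l => if l == k then f j else
     var_subst (word_of f (subst_symbols k j s)) h l) s by [].
apply: eq_eval_symbols => l ls.
have := symbol_vars_sorted s; rewrite ltn_sorted_uniq_leq sE rcons_uniq => /andP[/andP[kvs _] _].
case: eqVneq => [->|lk].
  have kn : (index k (word_vars (word_of f s)) < m.+1)%N.
    by rewrite word_vars_word_of sE -cats1 index_cat (negbTE kvs) /= eqxx addn0 vsm.
  rewrite (var_subst_nth _ kn) /fpow_rcons.
  case: unliftP => // i iE; have := congr1 val iE; rewrite /= /bump.
  rewrite leqNgt ltn_ord add0n word_vars_word_of sE -cats1 index_cat (negbTE kvs) /= eqxx addn0 vsm.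
  by move=> mi; have := ltn_ord i; rewrite -mi ltnn.
have lvs : l \in vs by move: ls; rewrite sE mem_rcons inE (negbTE lk).
have ln : (index l (word_vars (word_of f (subst_symbols k j s))) < m)%N.
  by rewrite word_vars_word_of (symbol_vars_subst_last _ sE) -vsm index_mem.
have ln' : (index l (word_vars (word_of f s)) < m.+1)%N.
  by rewrite word_vars_word_of -[m]vsm -(size_rcons vs k) -sE index_mem.
rewrite (var_subst_nth _ ln) (var_subst_nth _ ln') /fpow_rcons.
have -> : Ordinal ln' = lift ord_max (Ordinal ln).
  apply: val_inj; rewrite /= /bump leqNgt ln add0n !word_vars_word_of.
  by rewrite (symbol_vars_subst_last _ sE) sE -cats1 index_cat lvs.
by rewrite liftK.
Qed.

Section Generic.
Variables (W : eqType) (lt : rel W) (c : nat -> G) (x : W -> G).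

Hypothesis x_avoids : forall a (s : seq (symbol (nat + W)%type)),
  (forall b sg, inr (inr b, sg) \in s -> lt b a) ->
  meager_word (word_of (constants c x) s) ->
  ~ exceptional (word_of (constants c x) s) (x a).

(** Variables are replaced from the last to the first.  The indices [a k]
    decrease with [k], so the last variable gets the earliest element, and the
    constants introduced in this way precede all the elements still to be
    substituted; each of them therefore avoids the exceptional set of the word
    obtained so far. *)
Lemma generic_eval_symbols (s : seq (symbol (nat + W)%type)) (a : nat -> W) :
  meager_word (word_of (constants c x) s) ->
  {in symbol_vars s &, forall k l, (k < l)%N -> lt (a l) (a k)} ->
  (forall b sg k, inr (inr b, sg) \in s -> k \in symbol_vars s -> lt b (a k)) ->
  eval_symbols (constants c x) (x \o a) s <> 1%g.
Proof.
have [n] := ubnP (size (symbol_vars s)); elim: n s => // n IH s sn sm adec sa.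
have [vs [k sE]] : exists vs k, symbol_vars s = rcons vs k.
  case: sm; rewrite /word_arity word_vars_word_of.
  by case/lastP: (symbol_vars s) => // vs k _ _; exists vs, k.
have ks : k \in symbol_vars s by rewrite sE mem_rcons mem_head.
have := x_avoids (fun b sg bs => sa b sg k bs ks) sm.
have arE : word_arity (word_of (constants c x) s) = (size vs).+1.
  by rewrite /word_arity word_vars_word_of sE size_rcons.
rewrite /exceptional arE eqSS /=.
have -> : x (a k) = constants c x (inr (a k)) by [].
case: (eqVneq (size vs) 0%N) => [vs0|vs0].
  rewrite /= /solutions /= word_eval_word_of => H1 H2; apply: H1; rewrite -H2.
  apply: eq_eval_symbols => l ls.
  have lk : l = k by move: ls; rewrite sE (size0nil vs0) inE => /eqP.
  have ln : (index l (word_vars (word_of (constants c x) s)) < 1)%N.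
    by rewrite word_vars_word_of sE lk (size0nil vs0) /= eqxx.
  by rewrite (var_subst_nth _ ln) lk.
move=> /contrapT; rewrite (fiber_solutions _ _ sE erefl) => fm.
have := eval_symbols_subst (constants c x) k (inr (a k)) (x \o a) s.
have s'E := symbol_vars_subst_last (inr (a k)) sE.
have <- : eval_symbols (constants c x) (x \o a) s =
  eval_symbols (constants c x) (fun l => if l == k then constants c x (inr (a k)) else (x \o a) l) s.
  by apply: eq_eval_symbols => l _; case: eqVneq => [->|].
move=> <-; apply: IH.
- by rewrite s'E; move: sn; rewrite sE size_rcons ltnS.
- by split; rewrite /word_arity word_vars_word_of s'E// lt0n.
- by move=> l l'; rewrite !symbol_vars_subst => /andP[ls _] /andP[l's _]; apply: adec.
- move=> b sg l /mapP[q qs]; rewrite symbol_vars_subst => + /andP[ls lk].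
  case: q qs => [[i sg']|[j sg']] /= qs; last first.
    by case=> jE sgE; subst; apply: sa qs ls.
  case: ifP => // _ [-> _]; apply: adec => //.
  move: ls; rewrite sE mem_rcons inE (negbTE lk) /= => lvs.
  have := symbol_vars_sorted s; rewrite sE => /=.
  rewrite -cats1 (sorted_pairwise ltn_trans) pairwise_cat => /and3P[/allrelP H _ _].
  by apply: H => //; rewrite inE.
Qed.

End Generic.

End Exceptional.
Arguments solutions {G} n w _.

(** * Category in topological groups *)

Section TopologicalGroup.
Context {G : topologicalGroupType}.

Lemma mulg_continuous2 (T : topologicalType) (u v : T -> G) :
  continuous u -> continuous v -> continuous (fun t => u t * v t)%g.
Proof.
move=> uc vc t; apply: (@continuous_comp T (G * G)%type G (fun t => (u t, v t))
    (fun p => p.1 * p.2)%g).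
  by apply: cvg_pair; [exact: uc|exact: vc].
exact: mulg_continuous.
Qed.

Lemma invg_continuous1 (T : topologicalType) (u : T -> G) :
  continuous u -> continuous (fun t => (u t)^-1)%g.
Proof. by move=> uc t; apply: continuous_comp; [exact: uc|exact: invg_continuous]. Qed.

Definition translate (g z : G) : G := (g * z)%g.

Lemma mulgl_continuous (g : G) : continuous (translate g).
Proof. by apply: mulg_continuous2 => t; [exact: cvg_cst|exact: cvg_id]. Qed.

Lemma open_mulgl (g : G) (U : set G) : open U -> open (translate g @^-1` U).
Proof. by move=> oU; apply: open_comp => // ? _; exact: mulgl_continuous. Qed.

Lemma meager_mulgl (g : G) (A : set G) : meager A -> meager (translate g @^-1` A).
Proof.
apply: meager_preimage; first exact: mulgl_continuous.
move=> U oU; have -> : translate g @` U = translate (g^-1)%g @^-1` U.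
  apply/seteqP; split=> [_ [u Uu <-]|u Uu] /=; first by rewrite /translate mulKg.
  by exists (g^-1 * u)%g => //; rewrite /translate mulVKg.
exact: open_mulgl.
Qed.

(** Let [U] be open and equal to [H] up to a meager set, and [u] in [U].  If
    [g * u] is in [U], then [U] meets its translate by [g] in a nonempty open
    set, on which [H] and its translate by [g] are both comeager; by Baire's
    theorem they share a point, whence [g] is in [H]. *)
Lemma Pettis (H : set G) : compact [set: G] -> hausdorff_space G ->
  subgroup H -> ~ meager H -> property_of_Baire H -> nbhs 1%g H.
Proof.
move=> Gc Gh [H1 HM HV] Hnm [U oU HU].
have UHm : meager (U `\` H) by apply: meager_subset HU => x ?; right.
have [u Uu] : U !=set0.
  apply/set0P/eqP => U0; apply: Hnm; apply: meager_subset HU => x Hx.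
  by left; split=> //; rewrite U0.
have uc : continuous (fun g : G => g * u)%g.
  by apply: mulg_continuous2 => t; [exact: cvg_id|exact: cvg_cst].
have : nbhs 1%g ((fun g : G => g * u)%g @^-1` U).
  apply: open_nbhs_nbhs; split; last by rewrite /preimage /= mul1g.
  by apply: open_comp => // ? _; exact: uc.
apply: filterS => g /= Ugu; apply: contrapT => Hg.
apply: (@Baire_compact _ (U `&` translate (g^-1)%g @^-1` U) Gc Gh).
- by apply: openI => //; exact: open_mulgl.
- by exists (g * u)%g; split=> //=; rewrite /translate mulKg.
apply: meager_subset (meagerU UHm (meager_mulgl (g^-1)%g UHm)) => z [Uz Ugz].
have [Hz|Hz] := pselect (H z); last by left.
right; split=> // Hgz; apply: Hg.
by have := HM _ _ Hz (HV _ Hgz); rewrite /translate invgM invgK mulVKg.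
Qed.

Lemma dense_cosets (H D : set G) : nbhs 1%g H ->
  (forall U : set G, open U -> U !=set0 -> exists2 x, U x & D x) ->
  forall g, exists2 d, D d & H (d^-1 * g)%g.
Proof.
move=> H1 Dd g.
have vc : continuous (fun z : G => z^-1 * g)%g.
  by apply: mulg_continuous2 => t; [exact: invg_continuous|exact: cvg_cst].
have [||d Hd Dd'] := Dd ((fun z : G => z^-1 * g)%g @^-1` H°).
- by apply: open_comp; [move=> ? _; exact: vc|exact: open_interior].
- by exists g; rewrite /preimage /= mulVg.
by exists d => //; exact: interior_subset Hd.
Qed.

Lemma word_eval_continuous (w : word G) n :
  continuous (fun h : fpow G n => word_eval w h).
Proof.
rewrite /word_eval; suff : forall r : word G, continuous
    (fun h : fpow G n => \prod_(l <- r) letter_eval (var_subst w h) l)%g by apply.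
elim=> [|l r IH].
  have -> : (fun h : fpow G n =>
      \prod_(l <- [::]) letter_eval (var_subst w h) l)%g = fun=> 1%g.
    by apply/funext => h; rewrite big_nil.
  by move=> x; apply: cvg_cst; apply: nbhs_filter.
have -> : (fun h : fpow G n =>
      \prod_(l' <- l :: r) letter_eval (var_subst w h) l')%g =
    fun h => (letter_eval (var_subst w h) l *
      \prod_(l' <- r) letter_eval (var_subst w h) l')%g.
  by apply/funext => h; rewrite big_cons.
apply: mulg_continuous2 => //.
have vc k : continuous (fun h : fpow G n => var_subst w h k).
  rewrite /var_subst; case: insubP => [j _ _|_] /=.
    exact: (@proj_continuous 'I_n (fun=> G) j).
  by move=> x; apply: cvg_cst; apply: nbhs_filter.
case: l => [g|k|k] /=; [by move=> x; apply: cvg_cst; apply: nbhs_filter|exact: vc|].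
exact: invg_continuous1.
Qed.

(** The set of solutions is closed, and it contains no nonempty open set because
    such a set would meet [D^n]. *)
Lemma solutions_meager (w : word G) (D : set G) n : hausdorff_space G ->
  (forall U : set G, open U -> U !=set0 -> exists2 x, U x & D x) ->
  (forall h : fpow G n, (forall i, D (h i)) -> word_eval w h <> 1%g) ->
  meager (solutions n w).
Proof.
move=> Gh Dd Dw; apply/nowhere_dense_meager/nowhere_dense_closedP.
  have -> : solutions n w = (fun h : fpow G n => word_eval w h) @^-1` [set 1%g].
    by apply/seteqP; split.
  apply: closed_comp; first by move=> ? _; exact: word_eval_continuous.
  apply: compact_closed => //; exact: compact_set1.
move=> O oO OS; apply/seteqP; split=> // h Oh; exfalso.
have [|h' /OS] := dense_fpow Dd oO; first by exists h.
by move=> wh' /Dw; apply.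
Qed.

(** If one point is open, all are by translation; but in an infinite compact
    space the filter of cofinite sets has a cluster point, which is not open. *)
Lemma infinite_compact_perfect : infinite_set [set: G] -> compact [set: G] ->
  perfect_set [set: G].
Proof.
move=> Ginf Gc; apply/perfectTP => x ox.
have o1 (y : G) : open [set y].
  have := open_mulgl (x * y^-1)%g ox; congr open; apply/seteqP.
  split=> z; rewrite /translate /=; last by move=> ->; rewrite mulgVK.
  by move=> /(congr1 (translate (x * y^-1)^-1)%g); rewrite /translate mulKg invgM invgK mulgVK => ->.
pose F := filter_from [set B : set G | finite_set B] setC.
have FF : ProperFilter F.
  apply: filter_from_proper.
    apply: filter_from_filter; first by exists set0; exact: finite_set0.
    by move=> B C fB fC; exists (B `|` C); [rewrite /= finite_setU|rewrite setCU].
  move=> B fB; apply/set0P/eqP => /(congr1 setC); rewrite setCK setC0 => BT.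
  by rewrite BT in fB.
have [|p [_ clp]] := Gc F FF; first exact: filterT.
have Fp : F (~` [set p]) by exists [set p] => //; exact: finite_set1.
have np : nbhs p [set p] by apply: open_nbhs_nbhs; split.
by have [z []] := clp _ _ Fp np.
Qed.

End TopologicalGroup.

(** * The two constructions of a subgroup *)

Section Lift.
Context {G : groupType}.
Variables (W : eqType) (lt : rel W) (c : nat -> G) (x : W -> G) (a : W).

(** A word with constants below [a] is coded over the initial segment of [a];
    this is what bounds the number of such words. *)
Lemma word_of_restrict (s : seq (symbol (nat + W)%type)) :
  (forall b sg, inr (inr b, sg) \in s -> lt b a) ->
  exists s' : seq (symbol (nat + {b | lt b a})%type),
    word_of (constants c (fun b => x (sval b))) s' = word_of (constants c x) s.
Proof.
elim: s => [|q s IH] sa; first by exists [::].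
have [|s' s'E] := IH; first by move=> b sg bs; apply: (sa b sg); rewrite inE bs orbT.
suff [q' qE] : exists q', letter_of (constants c (fun b : {b | lt b a} => x (sval b))) q' =
    letter_of (constants c x) q.
  by exists (q' :: s'); rewrite /word_of /= qE -/(word_of _ _) s'E.
case: q sa => [p|[[n|b] sg]] sa; first by exists (inl p).
  by exists (inr (inl n, sg)).
by exists (inr (inr (exist _ b (sa b sg (mem_head _ _))), sg)).
Qed.

End Lift.

Section Construction.
Context {G : topologicalGroupType}.
Hypothesis Ghausdorff : hausdorff_space G.
Variables (d : nat -> G).
Hypothesis d_dense :
  forall U : set G, open U -> U !=set0 -> exists2 x, U x & generated d x.

Section Omit.
Variables (W : eqType) (w0 : W) (le : rel W) (t : G) (x : W -> G).
Hypotheses (le_total : total le) (le_trans : transitive le).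
Hypothesis t_d : ~ generated d t.

(** The inverse of [t] comes first, so that the equation [v = t] becomes the word
    [t^-1 * v]; the generators of the dense subgroup follow. *)
Definition base_constants (n : nat) : G := if n is m.+1 then d m else (t^-1)%g.

Hypothesis x_avoids : forall a (s : seq (symbol (nat + W)%type)),
  (forall b sg, inr (inr b, sg) \in s -> le b a && (b != a)) ->
  meager_word (word_of (constants base_constants x) s) ->
  ~ exceptional (word_of (constants base_constants x) s) (x a).

(** A product [l] equal to [t] is turned into a word [s] by listing the indices
    occurring in it in decreasing order and replacing the [n]-th of them by the
    [n]-th variable.  When the variables take values in the dense subgroup the
    word cannot evaluate to 1, as [t] is outside of it; so its set of solutions is
    meager, and generic elements cannot solve it either. *)
Lemma generated_omits : ~ generated (constants d x) t.
Proof.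
move=> [l _ lt].
pose bs := sort (fun b b' => le b' b)
  (undup (pmap (fun p : (nat + W) * bool => if p.1 is inr b then Some b else None) l)).
have bsl b sg : (inr b, sg) \in l -> b \in bs.
  move=> bl; rewrite mem_sort mem_undup mem_pmap; apply/mapP.
  by exists (inr b, sg).
pose phi (p : (nat + W) * bool) : symbol (nat + W)%type :=
  match p.1 with inl n => inr (inl n.+1, p.2) | inr b => inl (index b bs, p.2) end.
pose f := constants base_constants x.
pose s : seq (symbol (nat + W)%type) := inr (inl 0%N, true) :: map phi l.
have evalE v : eval_symbols f v s = (t^-1 * \prod_(p <- l) symbol_value f v (phi p))%g.
  by rewrite /eval_symbols big_cons big_map.
pose a := nth w0 bs.
have s1 : eval_symbols f (x \o a) s = 1%g.
  suff vE : (\prod_(p <- l) symbol_value f (x \o a) (phi p))%g = t.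
    by rewrite evalE vE mulVg.
  rewrite -lt.
  rewrite !big_seq; apply: eq_bigr => -[[n|b] sg] bl //=.
  by rewrite /a nth_index// (bsl _ _ bl).
have sD v : (forall k, generated d (v k)) -> eval_symbols f v s <> 1%g.
  move=> Dv; rewrite evalE => /(congr1 (fun z => t * z)%g); rewrite mulVKg mulg1 => tE.
  apply: t_d; rewrite -tE; apply: subgroup_prod; first exact: generated_subgroup.
  move=> [[n|b] sg] _ /=; apply: subgroup_signed.
  - exact: generated_subgroup.
  - exact: generated_gen.
  - exact: generated_subgroup.
  - exact: Dv.
have D1 : generated d 1%g by have [] := generated_subgroup d.
have vars : symbol_vars s <> [::].
  move=> s0.
  apply: (sD (fun=> 1%g)) => //.
  have -> : eval_symbols f (fun=> 1%g) s = eval_symbols f (x \o a) s; last exact: s1.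
    by apply: eq_eval_symbols => k; rewrite s0.
have sm : meager_word (word_of f s).
  split; first by rewrite /word_arity word_vars_word_of lt0n size_eq0; apply/eqP.
  apply: (solutions_meager Ghausdorff d_dense) => h Dh; rewrite word_eval_word_of.
  apply: sD => k; rewrite /var_subst; case: insubP => //= *; exact: Dh.
apply: (@generic_eval_symbols G W _ base_constants x x_avoids s a sm).
- have ltbs k : k \in symbol_vars s -> (k < size bs)%N.
    rewrite mem_symbol_vars => /= /hasP[_ /mapP[[[n|b] sg] bl ->]] //= /eqP[<-].
    by rewrite index_mem (bsl _ _ bl).
  move=> k k' /ltbs kb /ltbs k'b kk'.
  have bss : sorted (fun b b' => le b' b) bs by apply: sort_sorted => ? ?; exact: le_total.
  rewrite /a (sorted_ltn_nth (leT := fun b b' => le b' b))//; last 1 first.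
    by move=> y z u zy yu; exact: le_trans yu zy.
  by rewrite nth_uniq ?sort_uniq ?undup_uniq// gtn_eqF.
- by move=> b sg k; rewrite inE /= => /mapP[[[n|b'] sg'] _].
- exact: s1.
Qed.

End Omit.

Hypothesis Gcompact : compact [set: G].
Variable b : nat -> set G.
Hypothesis b_basis : forall x (U : set G), nbhs x U -> exists2 n, b n `<=` U & b n x.

(** The infinite set [nat + X] absorbs products with countable sets and finite
    sequences. *)
Lemma cantor_embeds_symbols (X : Type) :
  embeds cantor_space (seq (symbol (nat + X)%type)) -> embeds cantor_space X.
Proof.
move=> cX; apply/cantor_embeds_sum/(embedsT cX).
have Yinf : embeds nat (nat + X) by exists inl => ? ? [].
apply: embeds_seq => //; apply: embeds_sum => //.
  exact: countable_embeds.
by apply: embeds_prod => //; [exists id|exact: countable_embeds].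
Qed.

(** The exceptional sets to be avoided at stage [a] form a family of fewer than
    continuum many Kuratowski-Ulam-Markov sets.  If no value were possible, their
    union would contain the complement of a meager set, so that they would form
    a cover, which has at least as many members as [F]. *)
Lemma generic_family (t : G) (F : set (set G)) :
  is_kum F -> embeds cantor_space F ->
  exists (le : rel cantor_space) (x : cantor_space -> G),
  [/\ total le, transitive le,
   forall a (s : seq (symbol (nat + cantor_space)%type)),
     (forall b sg, inr (inr b, sg) \in s -> le b a && (b != a)) ->
     meager_word (word_of (constants (base_constants t) x) s) ->
     ~ exceptional (word_of (constants (base_constants t) x) s) (x a) &
   forall a, meager (coded_Fsigma b a) -> ~ coded_Fsigma b a (x a)].
Proof.
move=> [_ Fmin] cF.
have [le [le_total le_trans _ le_wf le_small]] := small_well_order cantor_space.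
pose lt (b a : cantor_space) := le b a && (b != a).
pose P a (y : {b | lt b a} -> G) (g : G) :=
  (forall s, meager_word (word_of (constants (base_constants t) y) s) ->
    ~ exceptional (word_of (constants (base_constants t) y) s) g) /\
  (meager (coded_Fsigma b a) -> ~ coded_Fsigma b a g).
have [|x xP] := @well_founded_choice _ G lt P le_wf; last first.
  exists le, x; split=> // a; last by have [] := xP a.
  move=> s sa; have [s' <-] := @word_of_restrict G _ lt (base_constants t) x a s sa.
  by have [+ _] := xP a; apply.
move=> a y; apply: contrapT => Ng; apply: (le_small a); apply: cantor_embeds_symbols.
pose w s := word_of (constants (base_constants t) y) s.
pose E := [set exceptional (w s) | s in [set s | meager_word (w s)]].
have FE : F #<= E.
  apply: Fmin; split; first by move=> _ [s sm <-]; exact: exceptional_KUM.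
  have [M Mm FM] : exists2 M : set G, meager M &
      (meager (coded_Fsigma b a) -> coded_Fsigma b a `<=` M).
    have [Fm|Fm] := pselect (meager (coded_Fsigma b a)); first by exists (coded_Fsigma b a) => // _ z.
    exists set0; last by move=> /Fm.
    apply: nowhere_dense_meager.
    by rewrite /nowhere_dense closure0 interior0.
  apply: meager_subset Mm => g /= gE; apply: contrapT => gM; apply: Ng; exists g.
  split; last by move=> /FM Fm /Fm.
  by move=> s sm gs; apply: gE; exists (exceptional (w s)) => //; exists s.
apply: (embedsT cF); apply/card_leTE.
have /card_leE e1 := FE.
have /card_leE e2 : E #<= [set: seq (symbol (nat + {b | lt b a})%type)].
  exact: card_le_trans (card_image_le _ _) (card_leT _).
apply/card_leTE/(embedsT e1)/(embedsT e2).
by exists set_val; apply: val_inj.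
Qed.

(** A meager subgroup would be contained in a meager F_sigma set, coded by some
    [a], which [x a] avoids. *)
Lemma non_Baire_subgroup_large_nonmeager (F : set (set G)) (t : G) : ~ generated d t ->
  is_kum F -> embeds cantor_space F ->
  exists H : set G, subgroup H /\ ~ property_of_Baire H.
Proof.
move=> t_d Fkum cF; have [le [x [lt ltr xav xM]]] := generic_family t Fkum cF.
exists (generated (constants d x)).
have Hsub := generated_subgroup (constants d x); split=> // HB.
have Hnm : ~ meager (generated (constants d x)).
  move=> [C Cnd HC].
  have [|a aE] := @coded_FsigmaE G b (fun k => closure (C k)) b_basis.
    by move=> k; exact: closed_closure.
  apply: (xM a); rewrite -aE.
    exists (fun k => closure (C k)) => // k.
    by rewrite /nowhere_dense -(closure_id _).1; [exact: Cnd|exact: closed_closure].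
  have := generated_gen (constants d x) (inr a); rewrite HC => -[k _ Ck].
  by exists k => //; exact: subset_closure.
have H1 := Pettis Gcompact Ghausdorff Hsub Hnm HB.
apply: (generated_omits (fun=> false) lt ltr t_d xav).
have [g Dg Hg] := dense_cosets H1 d_dense t.
rewrite -[t](mulVKg g); have [_ HM _] := Hsub; apply: HM => //.
case: Dg => l _ <-; apply: subgroup_prod => // -[n sg] _.
by apply: subgroup_signed => //; exact: (generated_gen (constants d x) (inl n)).
Qed.

(** Were the generated subgroup [H] to have the property of Baire, every
    element of [G] would be the product of one in a countable subgroup and one
    in [H], so that the Cantor space would embed into words over [X]. *)
Lemma non_Baire_subgroup_small_nonmeager (X : Type) (y : X -> G) : embeds cantor_space G ->
  ~ meager (range y) -> ~ embeds cantor_space X ->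
  exists H : set G, subgroup H /\ ~ property_of_Baire H.
Proof.
move=> cG ynm cX; exists (generated y).
have Hsub := generated_subgroup y; split=> // HB; apply: cX.
have Hnm : ~ meager (generated y).
  apply: contra_not ynm; apply: meager_subset => _ [i _ <-]; exact: generated_gen.
have H1 := Pettis Gcompact Ghausdorff Hsub Hnm HB.
apply: cantor_embeds_sum; apply: (embedsT cG).
have Yinf : embeds nat (nat + X) by exists inl => ? ? [].
apply: (@embedsT (seq (nat * bool) * seq (X * bool))); last first.
  apply: embeds_prod => //; first exact: countable_embeds.
  apply: embeds_seq => //; apply: embeds_prod => //; last exact: countable_embeds.
  by exists inr => ? ? [].
apply: (embeds_surj (f := fun p => (\prod_(q <- p.1) signed q.2 (d q.1) *
  \prod_(q <- p.2) signed q.2 (y q.1))%g)) => g.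
have [z [l _ lz] [l' _ lg]] := dense_cosets H1 d_dense g.
by exists (l, l'); rewrite /= lz lg mulVKg.
Qed.

End Construction.

Theorem theorem8 (R : realType) (G : topologicalGroupType)
    (G_infinite : infinite_set [set: G]%classic)
    (G_metrizable : metrizable R G)
    (G_profinite : profinite G)
    (nonM_kum : nonM_le_kum G) :
  exists H : set G, subgroup H /\ ~ property_of_Baire H.
Proof.
have [Gc Gh Gtd] := G_profinite.
have Gcl : cantor_like G.
  split=> //; first exact: infinite_compact_perfect.
  exact: totally_disconnected_zero_dimensional.
have [/second_countable_seq[b b_basis] /(_ Gcl)[f [fbij fc fcl]]] :=
  metrizable_compact (1%g : G) G_metrizable Gc.
have fI : injective f := bij_inj fbij.
have fo U : open U -> open (f @` U).
  move=> oU; rewrite -[_ @` _]setCK; apply: closed_openC.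
  rewrite (_ : ~` _ = f @` (~` U)); first by apply: fcl; exact: open_closedC.
  apply/seteqP; split=> [z|_ [u Uu <-] [v Uv /fI vu]]; last by rewrite vu in Uv.
  have [g gK fK] := fbij => Uz; exists (g z) => // Ugz.
  by apply: Uz; exists (g z).
pose d n := xget (1%g : G) (b n).
have d_dense (U : set G) : open U -> U !=set0 -> exists2 x, U x & generated d x.
  move=> oU [x Ux]; have [n bU bx] := b_basis x U (open_nbhs_nbhs (conj oU Ux)).
  exists (d n); last exact: generated_gen.
  by apply: bU; rewrite /d; case: xgetP => [z _ //|/(_ x)].
have cG : embeds cantor_space G by exists f.
have [A [F [[Anm _] Fkum AF]]] := nonM_kum.
have [cA|cA] := pselect (embeds cantor_space A).
  have [t t_d] : exists t, ~ generated d t.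
    apply: contrapT => Nt; apply/cantor_uncountable/(embedsT cG).
    apply: (@embedsT (seq (nat * bool))); last exact: embeds_count.
    apply: (embeds_surj (f := fun l => \prod_(p <- l) signed p.2 (d p.1))%g) => g.
    have [l _ lg] : generated d g by apply: contrapT => ?; apply: Nt; exists g.
    by exists l.
  apply: (non_Baire_subgroup_large_nonmeager Gh d_dense Gc b_basis t_d Fkum).
  by apply: embedsT cA _; apply/card_leE.
apply: (@non_Baire_subgroup_small_nonmeager G Gh d d_dense Gc A (fun u => f (set_val u))) => //.
apply: contra_not Anm => /(meager_preimage fc fo); apply: meager_subset => u Au.
by exists (SigSub (mem_set Au)).
Qed.
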